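(* For a measure space and $p\in\mathbb{R}\setminus\{0\}$, consider the inequality $$\int (f+g)^p\le\left(1+\frac{2^{2/p}\|fg\|_{p/2}}{\left(\|f\|_p^p+\|g\|_p^p\right)^{2/p}}\right)^{p-1}\int\left(f^p+g^p\right).\qquad(I_p)$$ Suppose that for some $p\ge2$, $(I_p)$ is valid for all measurable $f,g\ge0$ with $0<\int f^p+\int g^p<\infty$. Then $(I_{2p})$ is valid for all measurable $f,g\ge0$ with $0<\int f^{2p}+\int g^{2p}<\infty$. Likewise, if for some $p<0$ the reverse of $(I_p)$ (with $\ge$ in place of $\le$) is valid for all measurable $f,g>0$ with $0<\int f^p+\int g^p<\infty$, then the reverse of $(I_{2p})$ is valid for all measurable $f,g>0$ with $0<\int f^{2p}+\int g^{2p}<\infty$.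
   Context: For every real $p\neq0$ one writes $\|f\|_p:=\left(\int|f|^p\right)^{1/p}$; integrals are with respect to the measure of the given measure space. *)

(* Defs.v *)
From HB Require Import structures.
From mathcomp Require Import all_boot all_order all_algebra.
From mathcomp Require Import all_classical all_reals all_analysis.

Set Implicit Arguments.
Unset Strict Implicit.
Unset Printing Implicit Defensive.

Import Order.TTheory GRing.Theory Num.Theory.
Local Open Scope classical_set_scope.
Local Open Scope ring_scope.

(* Both sides are kept in the extended reals, so no integral is silently
   replaced by 0 when infinite. For r%:E with r real and nonzero (possibly
   negative), 'N[mu]_(r%:E)[f] unfolds to (\int |f|^r)^(1/r).
   The conventions of powR and poweR at 0 and +oo for negative exponents are
   never used below: for p < 0 the functions are positive and, under the
   condition 0 < \int f^p + \int g^p < +oo, every quantity raised to a negative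
   power lies in ]0, +oo[. *)

Definition sum_lhs (d : measure_display) (T : measurableType d) (R : realType)
    (mu : {measure set T -> \bar R}) (p : R) (f g : T -> R) : \bar R :=
  (\int[mu]_x ((f x + g x) `^ p)%R%:E)%E.

Definition sum_rhs (d : measure_display) (T : measurableType d) (R : realType)
    (mu : {measure set T -> \bar R}) (p : R) (f g : T -> R) : \bar R :=
  ((1 + (2 `^ (2 / p))%R%:E * 'N[mu]_((p / 2)%R%:E)[EFin \o (f \* g)%R]
        / ('N[mu]_(p%:E)[EFin \o f] `^ p + 'N[mu]_(p%:E)[EFin \o g] `^ p)
            `^ (2 / p)%R)
     `^ (p - 1)%R
   * \int[mu]_x (f x `^ p + g x `^ p)%R%:E)%E.

Definition ineqI (d : measure_display) (T : measurableType d) (R : realType)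
    (mu : {measure set T -> \bar R}) (p : R) (f g : T -> R) : Prop :=
  (sum_lhs mu p f g <= sum_rhs mu p f g)%E.

Definition rev_ineqI (d : measure_display) (T : measurableType d)
    (R : realType) (mu : {measure set T -> \bar R}) (p : R) (f g : T -> R)
    : Prop :=
  (sum_lhs mu p f g >= sum_rhs mu p f g)%E.

Definition finite_pos_mass (d : measure_display) (T : measurableType d)
    (R : realType) (mu : {measure set T -> \bar R}) (p : R) (f g : T -> R)
    : Prop :=
  (0 < \int[mu]_x (f x `^ p)%R%:E + \int[mu]_x (g x `^ p)%R%:E < +oo)%E.

Definition ineqI_valid (d : measure_display) (T : measurableType d)
    (R : realType) (mu : {measure set T -> \bar R}) (p : R) : Prop :=
  forall f g : T -> R,
    measurable_fun setT f -> measurable_fun setT g ->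
    (forall x, 0 <= f x) -> (forall x, 0 <= g x) ->
    finite_pos_mass mu p f g -> ineqI mu p f g.

Definition rev_ineqI_valid (d : measure_display) (T : measurableType d)
    (R : realType) (mu : {measure set T -> \bar R}) (p : R) : Prop :=
  forall f g : T -> R,
    measurable_fun setT f -> measurable_fun setT g ->
    (forall x, 0 < f x) -> (forall x, 0 < g x) ->
    finite_pos_mass mu p f g -> rev_ineqI mu p f g.

(* Main.v *)
Require Import Defs.
From HB Require Import structures.
From mathcomp Require Import all_boot all_order all_algebra.
From mathcomp Require Import all_classical all_reals all_analysis.
From mathcomp Require Import measurable_realfun ring lra.

Import Order.TTheory GRing.Theory Num.Theory.
Import numFieldNormedType.Exports.
Local Open Scope classical_set_scope.
Local Open Scope ring_scope.

(** Write [M] for the integral of [f^p + g^p] and [X] for that of [(fg)^(p/2)].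
    The right-hand side of (I_p) is [H(2X/M) M] with
    [H(m) = (1 + m^(2/p))^(p-1)] ([sharp p m] below), and [0 <= 2X/M <= 1] by AM-GM.

    Doubling for [p >= 1]: expand [(f+g)^(2p) = ((f^2+g^2) + 2fg)^p] and bound
    it, by convexity, by [l^(1-p) (f^2+g^2)^p + (1-l)^(1-p) (2fg)^p]. The first
    term is controlled by (I_p) for [f^2, g^2]. With [a = (2X/M)^(1/p)], where
    now [M] and [X] are the integrals of [f^(2p) + g^(2p)] and [(fg)^p], the choice
    [l = (1+a^2)/(1+a)^2] makes the total exactly the right-hand side of (I_2p).

    For [p < 0] this argument points in the wrong direction, since both
    Minkowski's and Hoelder's inequalities are reversed. Instead the reverse of
    (I_p) is proved outright for every [p < 0]. [H] is convex on ]0, 1], so by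
    integrating its tangent at [2X/M] one is reduced to the inequality for two
    numbers. With [c = -ln(cosh w)/p], where [w] is [p/2] times the difference
    of the logarithms of the two numbers, the latter follows from
    [cosh(-w/p) <= e^(-c/p) cosh c], which combines the monotonicity of
    [u |-> e^(-u^2/2) cosh u] with [1 + ln(cosh w) >= sqrt(1 + w^2)]. *)

Lemma ge0_nondecreasing (R : realType) (f df : R -> R) :
  (forall x : R, 0 <= x -> is_derive x 1 f (df x)) ->
  (forall x, 0 <= x -> 0 <= df x) ->
  forall a b, 0 <= a -> a <= b -> f a <= f b.
Proof.
move=> hf hdf a b a0 ab.
have [||c] := @MVT_segment R f df a b ab.
- by move=> x; rewrite in_itv/= => /andP[ax _]; apply: hf; lra.
- apply/continuous_in_subspaceT => x; rewrite inE/= in_itv/= => /andP[ax _].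
  apply/differentiable_continuous/derivable1_diffP.
  by have := hf x (le_trans a0 ax) => -[].
rewrite in_itv/= => /andP[ac _] e.
by rewrite -subr_ge0 e mulr_ge0 ?subr_ge0//; apply: hdf; lra.
Qed.


(** * Hyperbolic functions and the comparison of [cosh (j * w)] with [ln (cosh w)] *)

Section hyperbolic.
Context {R : realType}.
Implicit Types u w c j : R.

Definition cosh u := (expR u + expR (- u)) / 2.
Definition sinh u := (expR u - expR (- u)) / 2.

#[local] Instance is_derive_cosh u : is_derive u 1 cosh (sinh u).
Proof. by apply: is_derive_eq; rewrite /GRing.scale/= /sinh; ring. Qed.

#[local] Instance is_derive_sinh u : is_derive u 1 sinh (cosh u).
Proof. by apply: is_derive_eq; rewrite /GRing.scale/= /cosh; ring. Qed.

Lemma coshN u : cosh (- u) = cosh u.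
Proof. by rewrite /cosh opprK addrC. Qed.

Lemma cosh_norm u : cosh `|u| = cosh u.
Proof. by case: (ger0P u) => //; rewrite coshN. Qed.

Lemma cosh0 : cosh 0 = 1.
Proof. by rewrite /cosh oppr0 expR0; field. Qed.

Lemma sinh0 : sinh 0 = 0.
Proof. by rewrite /sinh oppr0 subrr mul0r. Qed.

Lemma cosh_gt0 u : 0 < cosh u.
Proof. by rewrite divr_gt0// addr_gt0// expR_gt0. Qed.

Lemma cosh2B_sinh2 u : cosh u ^+ 2 - sinh u ^+ 2 = 1.
Proof.
have <- : expR u * expR (- u) = 1 by rewrite -expRD subrr expR0.
by rewrite /cosh /sinh; field.
Qed.

Lemma sinh_ge0 u : 0 <= u -> 0 <= sinh u.
Proof. by move=> u0; rewrite divr_ge0// subr_ge0 ler_expR; lra. Qed.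

Lemma cosh_le u w : 0 <= u -> u <= w -> cosh u <= cosh w.
Proof.
by apply: (@ge0_nondecreasing R cosh sinh) => x x0; exact: sinh_ge0.
Qed.

Lemma cosh_ge1 u : 1 <= cosh u.
Proof. by rewrite -cosh0 -(cosh_norm u); exact: cosh_le. Qed.

Lemma sinh_ge_id u : 0 <= u -> u <= sinh u.
Proof.
move=> u0; rewrite -subr_ge0.
have := @ge0_nondecreasing R (fun x => sinh x - x)
  (fun x => cosh x - 1) _ _ 0 u.
rewrite sinh0 subrr; apply => //.
by move=> x _; rewrite subr_ge0 cosh_ge1.
Qed.

Lemma sinh_le_mul_cosh u : 0 <= u -> sinh u <= u * cosh u.
Proof.
move=> u0; rewrite -subr_ge0.
have := @ge0_nondecreasing R (fun x => x * cosh x - sinh x)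
  (fun x => x * sinh x) _ _ 0 u.
rewrite sinh0 mul0r subrr; apply => //.
- by move=> x _; apply: is_derive_eq; rewrite /GRing.scale/=; ring.
- by move=> x x0; rewrite mulr_ge0// sinh_ge0.
Qed.

(** The function [e^(-x^2/2) cosh x] is nonincreasing for [x >= 0]: its derivative is
    [e^(-x^2/2) (sinh x - x cosh x)], and [sinh x <= x cosh x]. *)
Lemma gauss_cosh_le c u : 0 <= c -> c <= u ->
  cosh u <= expR ((u ^+ 2 - c ^+ 2) / 2) * cosh c.
Proof.
move=> c0 cu.
have h : - (expR (- (c ^+ 2 / 2)) * cosh c) <=
    - (expR (- (u ^+ 2 / 2)) * cosh u).
  apply: (@ge0_nondecreasing R (fun x => - (expR (- (x ^+ 2 / 2)) * cosh x))
    (fun x => expR (- (x ^+ 2 / 2)) * (x * cosh x - sinh x))) => // x x0.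
    by apply: is_derive_eq; rewrite /GRing.scale/=; field.
  by rewrite mulr_ge0 ?expR_ge0// subr_ge0 sinh_le_mul_cosh.
rewrite lerN2 in h; rewrite mulrBl expRD.
have e (x : R) : expR x * expR (- x) = 1 by rewrite -expRD subrr expR0.
have -> : cosh u = expR (u ^+ 2 / 2) * (expR (- (u ^+ 2 / 2)) * cosh u).
  by rewrite mulrA e mul1r.
by rewrite -[leRHS]mulrA ler_wpM2l ?expR_ge0.
Qed.

(* Both sides are [1] at [0], and the inequality of the derivatives, squared,
   is equivalent to [w ^+ 2 <= sinh w ^+ 2]. *)
Lemma ln_cosh_ge w : Num.sqrt (1 + w ^+ 2) <= 1 + ln (cosh w).
Proof.
wlog w0 : w / 0 <= w.
  move=> h; have := h `|w| (normr_ge0 w).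
  by rewrite cosh_norm real_normK ?num_real.
have h : ln (cosh 0) - Num.sqrt (1 + 0 ^+ 2) <=
    ln (cosh w) - Num.sqrt (1 + w ^+ 2).
  apply: (@ge0_nondecreasing R (fun x => ln (cosh x) - Num.sqrt (1 + x ^+ 2))
    (fun x => (cosh x)^-1 * sinh x - (2 * Num.sqrt (1 + x ^+ 2))^-1 * (2 * x)))
    => // x x0; have x1 : 0 < 1 + x ^+ 2 by rewrite ltr_pwDl// sqr_ge0.
    apply: is_deriveB.
      apply: (@is_derive1_comp _ (@ln R) cosh).
      exact: is_derive1_ln (cosh_gt0 x).
    apply: (@is_derive1_comp _ Num.sqrt (fun x => 1 + x ^+ 2)).
      exact: is_derive1_sqrt.
    by apply: is_derive_eq; rewrite /GRing.scale/=; ring.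
  have s0 : 0 < Num.sqrt (1 + x ^+ 2) by rewrite sqrtr_gt0.
  have -> (s : R) : (2 * s)^-1 * (2 * x) = x / s.
    by rewrite mulrC -mulf_div divff// mul1r.
  rewrite subr_ge0 ler_pdivrMr// -mulrA mulrC ler_pdivlMr ?cosh_gt0//.
  have [c0 sh0] := (ltW (cosh_gt0 x), sinh_ge0 _ x0).
  rewrite -ler_sqr ?nnegrE; [|exact: mulr_ge0|by rewrite mulr_ge0// ltW].
  rewrite [(x * _) ^+ 2]exprMn [(sinh x * _) ^+ 2]exprMn sqr_sqrtr ?(ltW x1)//.
  have /eqP := cosh2B_sinh2 x; rewrite subr_eq => /eqP ->.
  have : x ^+ 2 <= sinh x ^+ 2 by rewrite ler_sqr ?nnegrE// sinh_ge_id.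
  lra.
by move: h; rewrite cosh0 ln1 expr0n/= addr0 sqrtr1; lra.
Qed.

(** Put [L = ln (cosh w)]. If [j w <= j L], monotonicity of [cosh] suffices. Otherwise
    [gauss_cosh_le] leaves the exponent [j^2 (w^2 - L^2) / 2], which is at most [j^2 L]. *)
Lemma cosh_mul_le j w : 0 <= j ->
  cosh (j * w) <= expR (j ^+ 2 * ln (cosh w)) * cosh (j * ln (cosh w)).
Proof.
move=> j0; wlog w0 : w / 0 <= w.
  move=> h; have := h `|w| (normr_ge0 w).
  by rewrite cosh_norm -[j in j * `|w|](ger0_norm j0) -normrM cosh_norm.
set L := ln (cosh w); have L0 : 0 <= L by rewrite ln_ge0// cosh_ge1.
(* This is [ln_cosh_ge] squared: [1 + w^2 <= (1 + L)^2]. *)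
have Lw : w ^+ 2 <= L ^+ 2 + 2 * L.
  have := ln_cosh_ge w; rewrite -/L -ler_sqr ?nnegrE ?sqrtr_ge0 ?addr_ge0//.
  by rewrite sqr_sqrtr ?addr_ge0 ?sqr_ge0//; lra.
have [wL|Lw'] := leP (j * w) (j * L).
  apply: (le_trans (cosh_le _ _ _ wL)); first exact: mulr_ge0.
  rewrite ler_peMl ?(ltW (cosh_gt0 _))// -expR0 ler_expR.
  by rewrite mulr_ge0 ?sqr_ge0.
apply: (le_trans (gauss_cosh_le _ _ (mulr_ge0 j0 L0) (ltW Lw'))).
rewrite ler_wpM2r ?(ltW (cosh_gt0 _))// ler_expR !exprMn.
have := ler_wpM2l (sqr_ge0 j) Lw; lra.
Qed.

End hyperbolic.

(** * Convexity of [sharp p] for negative [p], and the inequality for two numbers *)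

Section sharp_function.
Context {R : realType}.
Implicit Types p m z x y : R.

Lemma lt0_ger_powR p x y : p < 0 -> 0 < x -> x <= y -> y `^ p <= x `^ p.
Proof.
move=> p0 x0 xy; have y0 := lt_le_trans x0 xy.
rewrite -[p]opprK !(powRN _ (- p)) lef_pV2 ?posrE ?powR_gt0//.
by apply: ge0_ler_powR; rewrite ?nnegrE ?oppr_ge0// ltW.
Qed.

Definition sharp p m := (1 + m `^ (2 / p)) `^ (p - 1).

(** The derivative of [sharp p], rewritten in [y = m^(1/p)] so that its monotonicity can be read off
    from that of [y / (1 + y^2)]. *)
Definition dsharp p m :=
  2 * (p - 1) / p * (m `^ p^-1 / (1 + m `^ p^-1 ^+ 2)) `^ (2 - p).

Lemma powR_half_sqr x p : x `^ (p / 2) ^+ 2 = x `^ p.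
Proof. by rewrite -powR_mulrn ?powR_ge0// -powRrM divfK. Qed.

Lemma is_derive_sharp p m : p < 0 -> 0 < m ->
  is_derive m 1 (sharp p) (dsharp p m).
Proof.
move=> p0 m0; have pn0 : p != 0 by rewrite lt_eqF.
have h0 : 0 < 1 + m `^ (2 / p) by rewrite addr_gt0// powR_gt0.
have d1 := is_derive1_powR (p - 1) h0.
have d2 : is_derive m 1 (fun u => 1 + u `^ (2 / p)) (2 / p * m `^ (2 / p - 1)).
  have d3 := is_derive1_powR (2 / p) m0.
  have := is_deriveD (is_derive_cst (1 : R) m (1 : R)) d3.
  by rewrite add0r.
have /is_derive_eq := @is_derive1_comp _ (@powR R ^~ (p - 1))
  (fun u => 1 + u `^ (2 / p)) m _ _ d1 d2; apply.
have y0 : 0 < m `^ p^-1 by rewrite powR_gt0.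
have -> : m `^ (2 / p) = m `^ p^-1 ^+ 2.
  by rewrite -powR_mulrn ?powR_ge0// -powRrM mulrC.
have -> : m `^ (2 / p - 1) = m `^ p^-1 `^ (2 - p).
  by rewrite -powRrM; congr (_ `^ _); field.
rewrite /dsharp; move: (m `^ p^-1) y0 => y y0.
have y1 : 0 < 1 + y ^+ 2 by rewrite ltr_pwDl// sqr_ge0.
rewrite (powRM _ (ltW y0)) ?invr_ge0 ?(ltW y1)//.
rewrite -(powR_inv1 (ltW y1)) -(powRrM (1 + y ^+ 2)).
have -> : -1 * (2 - p) = p - 1 - 1 by ring.
by field.
Qed.

(* With [y = m `^ p^-1 >= 1], the derivative is an increasing function of
   [y / (1 + y ^+ 2)]. *)
Lemma dsharp_le p m z : p < 0 -> 0 < m -> m <= z -> z <= 1 ->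
  dsharp p m <= dsharp p z.
Proof.
move=> p0 m0 mz z1; have z0 := lt_le_trans m0 mz.
have pV0 : p^-1 < 0 by rewrite invr_lt0.
have y1 : 1 <= z `^ p^-1.
  by have := lt0_ger_powR p^-1 z 1 pV0 z0 z1; rewrite powR1.
have yz : z `^ p^-1 <= m `^ p^-1 by exact: lt0_ger_powR.
set y := z `^ p^-1 in y1 yz *; set t := m `^ p^-1 in yz *.
rewrite /dsharp -/y -/t; apply: ler_wpM2l.
  by rewrite mulr_le0 ?invr_le0 ?ltW// pmulr_rlt0// subr_lt0; lra.
have t0 : 0 < t by lra.
have y0 : 0 < y by lra.
rewrite ge0_ler_powR ?nnegrE ?divr_ge0 ?addr_ge0 ?sqr_ge0//; try lra.
rewrite ler_pdivrMr ?ltr_pwDl ?sqr_ge0// mulrAC.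
rewrite ler_pdivlMr ?ltr_pwDl ?sqr_ge0//.
rewrite -subr_ge0.
have -> : y * (1 + t ^+ 2) - t * (1 + y ^+ 2) = (t - y) * (t * y - 1) by ring.
rewrite mulr_ge0 ?subr_ge0//; nra.
Qed.

(** The mean value theorem gives the slope of the chord as [dsharp p c] with [c] between [m] and
    [z]; [dsharp_le] compares it with [dsharp p m], in either order of [m] and [z]. *)
Lemma sharp_tangent p m z : p < 0 -> 0 < m -> m <= 1 -> 0 < z -> z <= 1 ->
  sharp p m + dsharp p m * (z - m) <= sharp p z.
Proof.
move=> p0 m0 m1 z0 z1.
have ct a b : 0 < a -> {within `[a, b], continuous (sharp p)}.
  move=> a0; apply/continuous_in_subspaceT => x.
  rewrite inE/= in_itv/= => /andP[ax _].
  apply/differentiable_continuous/derivable1_diffP.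
  by have [] := is_derive_sharp p x p0 (lt_le_trans a0 ax).
have dv a b : 0 < a -> forall x,
    x \in `]a, b[%R -> is_derive x 1 (sharp p) (dsharp p x).
  move=> a0 x; rewrite in_itv/= => /andP[ax _].
  by apply: is_derive_sharp => //; lra.
rewrite -lerBrDl; have [mz|/ltW zm] := leP m z.
- have [c] := MVT_segment mz (dv m z m0) (ct m z m0).
  rewrite in_itv/= => /andP[mc cz] ->.
  apply: ler_wpM2r; first by rewrite subr_ge0.
  exact: (dsharp_le _ _ _ p0 m0 mc (le_trans cz z1)).
- have [c] := MVT_segment zm (dv z m z0) (ct z m z0).
  rewrite in_itv/= => /andP[zc cm] e.
  have -> : sharp p z - sharp p m = dsharp p c * (z - m).
    by rewrite -(opprB (sharp p m)) e -mulrN opprB.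
  apply: ler_wnM2r; first by rewrite subr_le0.
  exact: (dsharp_le _ _ _ p0 (lt_le_trans z0 zc) cm m1).
Qed.

Lemma two_point_le p x y : p < 0 -> 0 < x -> 0 < y ->
  sharp p (2 * (x * y) `^ (p / 2) / (x `^ p + y `^ p)) * (x `^ p + y `^ p)
  <= (x + y) `^ p.
Proof.
move=> p0 x0 y0; have pn0 : p != 0 by rewrite lt_eqF.
(* Thus [x = e^(s + w/p)] and [y = e^(s - w/p)]. The number [c] is defined by [cosh w = e^(-pc)],
   which turns the argument of [sharp p] into [e^(pc)]. *)
set s := (ln x + ln y) / 2; set w := p * (ln x - ln y) / 2.
set L := ln (cosh w); set c := - p^-1 * L.
have powE u r : 0 < u -> u `^ r = expR (r * ln u).
  by move=> u0; rewrite /powR gt_eqF.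
have ee u r : (expR u) `^ r = expR (r * u) by rewrite powE ?expR_gt0// expRK.
have chE u : 2 * cosh u = expR u + expR (- u) by rewrite mulrC divfK.
have chw : cosh w = expR (- p * c).
  rewrite /c mulrA mulrNN mulfV// mul1r /L lnK// posrE cosh_gt0 //.
have sumE : x `^ p + y `^ p = 2 * expR (p * s) * expR (- p * c).
  rewrite -chw !powE// mulrAC chE [RHS]mulrC mulrDr -!expRD.
  by congr (expR _ + expR _); rewrite /s /w; field.
have prodE : (x * y) `^ (p / 2) = expR (p * s).
  by rewrite powE ?mulr_gt0// lnM// /s; congr expR; field.
have sumxy : x + y = 2 * expR s * cosh (- p^-1 * w).
  rewrite [RHS]mulrAC chE [RHS]mulrC mulrDr -!expRD addrC.
  rewrite -[in LHS](lnK x0) -[in LHS](lnK y0).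
  by congr (expR _ + expR _); rewrite /s /w; field.
have j0 : 0 <= - p^-1 by rewrite oppr_ge0 invr_le0 ltW.
(* For [j = -1/p] one has [j L = c] and [j^2 L = -c/p]. *)
have := cosh_mul_le _ w j0; rewrite -/L expr2 -mulrA -/c => hc.
have ch1 := cosh_ge1 c; have ch0 := cosh_gt0 c.
rewrite sumE prodE.
have -> : 2 * expR (p * s) / (2 * expR (p * s) * expR (- p * c)) = expR (p * c).
  rewrite invfM mulrA divff ?mul1r ?mulf_neq0 ?gt_eqF ?expR_gt0//.
  by rewrite -expRN mulNr opprK.
rewrite /sharp ee.
have -> : 1 + expR (2 / p * (p * c)) = 2 * expR c * cosh c.
  rewrite [RHS]mulrAC chE [RHS]mulrC mulrDr -!expRD.
  by rewrite subrr expR0 [RHS]addrC; congr (1 + expR _); field.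
rewrite sumxy.
have lhsE k : 0 < k -> (2 * expR s * (expR (- p^-1 * c) * k)) `^ p =
    2 `^ p * expR (p * s) * expR (- c) * k `^ p.
  move=> /ltW k0; rewrite !powRM ?mulr_ge0 ?expR_ge0// !ee !mulrA.
  by congr (_ * expR _ * _); rewrite /c; field.
(* The base in the middle term bounds [x + y] from above by [hc]; the negative power reverses the
   order. *)
apply: (@le_trans _ _ ((2 * expR s * (expR (- p^-1 * c) * cosh c)) `^ p));
  last first.
  apply: lt0_ger_powR => //.
    by apply: mulr_gt0 (cosh_gt0 _); rewrite mulr_gt0// expR_gt0.
  by rewrite ler_wpM2l// mulr_ge0 ?expR_ge0.
rewrite lhsE//.
rewrite [(2 * expR c * cosh c) `^ _]powRM ?mulr_ge0 ?expR_ge0 ?(ltW ch0)//.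
rewrite powRM ?expR_ge0// ee.
have -> : 2 `^ (p - 1) * expR ((p - 1) * c) * cosh c `^ (p - 1) *
    (2 * expR (p * s) * expR (- p * c)) =
   (2 * 2 `^ (p - 1)) * expR (p * s) * (expR ((p - 1) * c) * expR (- p * c)) *
     cosh c `^ (p - 1) by ring.
have -> : 2 * 2 `^ (p - 1) = 2 `^ p.
  by rewrite -{1}[2]powRr1// -powRD ?pnatr_eq0 ?implybT// addrC subrK.
rewrite -expRD; have -> : (p - 1) * c + - p * c = - c by ring.
(* After cancelling common factors, [cosh c ^ (p - 1) <= cosh c ^ p] remains, true since
   [cosh c >= 1]. *)
rewrite ler_wpM2l ?mulr_ge0 ?powR_ge0 ?expR_ge0//.
by rewrite ler_powR//; lra.
Qed.

Lemma powR_AGM p x y : 0 <= x -> 0 <= y ->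
  2 * (x * y) `^ (p / 2) <= x `^ p + y `^ p.
Proof.
move=> x0 y0; rewrite powRM// -!(powR_half_sqr _ p).
have := sqr_ge0 (x `^ (p / 2) - y `^ (p / 2)); lra.
Qed.

(** Multiplying the tangent inequality at [z = 2 (xy)^(p/2) / (x^p + y^p)] by [x^p + y^p] makes the
    lower bound linear in the two quantities whose integrals are known, with [m] a free constant. *)
Lemma sharp_tangent_powR p m x y : p < 0 -> 0 < m -> m <= 1 -> 0 < x -> 0 < y ->
  sharp p m * (x `^ p + y `^ p)
    + dsharp p m * (2 * (x * y) `^ (p / 2) - m * (x `^ p + y `^ p))
  <= (x + y) `^ p.
Proof.
move=> p0 m0 m1 x0 y0; apply: le_trans (two_point_le p x y p0 x0 y0).
have S0 : 0 < x `^ p + y `^ p by rewrite addr_gt0 ?powR_gt0.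
set S := x `^ p + y `^ p in S0 *; set z := _ / S.
have <- : z * S = 2 * (x * y) `^ (p / 2) by rewrite divfK// gt_eqF.
rewrite -mulrBl mulrA -mulrDl ler_wpM2r ?(ltW S0)//; apply: sharp_tangent => //.
  by rewrite divr_gt0// mulr_gt0// powR_gt0// mulr_gt0.
by rewrite ler_pdivrMr// mul1r powR_AGM// ltW.
Qed.

End sharp_function.

(** * Integrals of nonnegative real-valued functions *)

Section integral_ge0.
Context {R : realType} {d : measure_display} {T : measurableType d}.
Variable mu : {measure set T -> \bar R}.
Implicit Types h k : T -> R.

Let I h := (\int[mu]_x (h x)%:E)%E.

Lemma ge0_EFin_integralD h k :
  measurable_fun setT h -> measurable_fun setT k ->
  (forall x, 0 <= h x) -> (forall x, 0 <= k x) ->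
  I (fun x => h x + k x) = (I h + I k)%E.
Proof.
move=> mh mk h0 k0.
apply: (@ge0_integralD _ _ _ mu _ measurableT (EFin \o h) (EFin \o k))
  => [x _||x _|].
- by rewrite lee_fin.
- exact/measurable_EFinP.
- by rewrite lee_fin.
- exact/measurable_EFinP.
Qed.

Lemma ge0_EFin_integralZl h (c : R) :
  measurable_fun setT h -> (forall x, 0 <= h x) -> 0 <= c ->
  I (fun x => c * h x) = (c%:E * I h)%E.
Proof.
move=> mh h0 c0.
apply: (@ge0_integralZl_EFin _ _ _ mu _ measurableT (EFin \o h)) => // [x _|].
- by rewrite lee_fin.
- exact/measurable_EFinP.
Qed.

Lemma ge0_EFin_le_integral h k :
  measurable_fun setT h -> measurable_fun setT k ->
  (forall x, 0 <= h x) -> (forall x, h x <= k x) -> (I h <= I k)%E.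
Proof.
move=> mh mk h0 hk; apply: (ge0_le_integral mu measurableT) => [x _|||x _].
- by rewrite lee_fin.
- exact/measurable_EFinP.
- exact/measurable_EFinP.
- by rewrite lee_fin.
Qed.

(** A nonnegative [n] of integral zero vanishes almost everywhere, so [h = k] almost everywhere.
    This serves the degenerate case where the integral of the product is zero. *)
Lemma integral_eq0_eq_integral (n h k : T -> R) :
  measurable_fun setT n -> measurable_fun setT h -> measurable_fun setT k ->
  (forall x, 0 <= n x) -> I n = 0%E -> (forall x, n x = 0 -> h x = k x) ->
  I h = I k.
Proof.
move=> mn mh mk n0 In0 hk.
have /ae_eq_integral_abs : measurable_fun setT (EFin \o n).
  exact/measurable_EFinP.
move=> /(_ mu measurableT)[+ _].
have -> : (\int[mu]_x `|(EFin \o n) x| = I n)%E.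
  by apply: eq_integral => x _ /=; rewrite ger0_norm.
move=> /(_ In0) nae; apply: ae_eq_integral => //; do ?exact/measurable_EFinP.
by apply: filterS nae => x /= nx _; rewrite hk//; have [] := nx Logic.I.
Qed.

Lemma measurable_fun_powR h (p : R) : measurable_fun setT h ->
  measurable_fun setT (fun x => h x `^ p).
Proof. exact: (@measurableT_comp _ _ _ _ _ _ (@powR R ^~ p)). Qed.

End integral_ge0.

(** * The right-hand side as a real number, and the reverse inequality for negative exponents *)

Section sum_rhs.
Context {R : realType} {d : measure_display} {T : measurableType d}.
Variable mu : {measure set T -> \bar R}.

(** The mass condition makes [M] finite and positive, and the integrated AM-GM bound [2 X <= M]
    makes [X] finite. The roots in the norms then cancel against the outer powers, and everything
    can be computed in the reals. *)
Lemma sum_rhsE (p : R) (f g : T -> R) : p != 0 ->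
  measurable_fun setT f -> measurable_fun setT g ->
  (forall x, 0 <= f x) -> (forall x, 0 <= g x) ->
  finite_pos_mass mu p f g ->
  exists M X : R,
    [/\ 0 < M, 0 <= X /\ 2 * X <= M,
        (\int[mu]_x (f x `^ p + g x `^ p)%:E)%E = M%:E,
        (\int[mu]_x ((f x * g x) `^ (p / 2))%:E)%E = X%:E &
        sum_rhs mu p f g = (sharp p (2 * X / M) * M)%:E].
Proof.
move=> p0 mf mg f0 g0; rewrite /finite_pos_mass.
have [mfp mgp] := (measurable_fun_powR f p mf, measurable_fun_powR g p mg).
have mX := measurable_fun_powR _ (p / 2) (measurable_funM mf mg).
have mS : measurable_fun setT (fun x => f x `^ p + g x `^ p).
  exact: measurable_funD.
have [fp0 gp0] : (forall x, 0 <= f x `^ p) /\ (forall x, 0 <= g x `^ p).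
  by split => x; exact: powR_ge0.
have SD := ge0_EFin_integralD mu _ _ mfp mgp fp0 gp0; rewrite -SD.
set S := (\int[mu]_x _)%E in SD * => /andP[S0 Soo].
have SE : S = (fine S)%:E by rewrite fineK// ge0_fin_numE// ltW.
have M0 : 0 < fine S by rewrite -lte_fin -SE.
set M := fine S in SE M0.
set X' := (\int[mu]_x ((f x * g x) `^ (p / 2))%:E)%E.
have X0 : (0 <= X')%E.
  by apply: integral_ge0 => x _; rewrite lee_fin powR_ge0.
have XM : (2%:E * X' <= M%:E)%E.
  rewrite -SE -ge0_EFin_integralZl//; last by move=> x; exact: powR_ge0.
  apply: ge0_EFin_le_integral => //.
  - by apply: measurable_funM => //; exact: measurable_cst.
  - by move=> x; rewrite mulr_ge0 ?powR_ge0.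
  - by move=> x; exact: powR_AGM.
have XE : X' = (fine X')%:E.
  rewrite fineK// ge0_fin_numE//; case: X' X0 XM => [r _ _|_|//].
    by rewrite ltry.
  by rewrite gt0_muley ?lte_fin// leye_eq.
set X := fine X' in XE; rewrite XE -EFinM !lee_fin in X0 XM.
exists M, X; split => //.
rewrite /sum_rhs -/S SE !poweR_Lnorm//.
have normE h (r : R) : (forall x, 0 <= h x) ->
    (\int[mu]_x (`|(EFin \o h) x| `^ r) = \int[mu]_x (h x `^ r)%:E)%E.
  by move=> h0; apply: eq_integral => x _ /=; rewrite ger0_norm.
rewrite !normE// -SD SE.
have -> : ('N[mu]_((p / 2)%R%:E)[EFin \o (f \* g)%R] = (X `^ (2 / p))%:E)%E.
  rewrite unlock invf_div -poweR_EFin -XE normE// => x.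
  by rewrite mulr_ge0.
(* The exceptional value of the extended inverse at zero is excluded by [M^(2/p) > 0]. *)
rewrite poweR_EFin inver gt_eqF ?powR_gt0// -!EFinM.
congr ((1 + _) `^ _ * _)%:E.
rewrite !powRM ?mulr_ge0 ?invr_ge0 ?(ltW M0)//; congr (_ * _).
by rewrite -(powR_inv1 (ltW M0)) -powRrM mulN1r powRN.
Qed.

Lemma rev_ineqI_valid_lt0 (p : R) : p < 0 -> rev_ineqI_valid mu p.
Proof.
move=> p0 f g mf mg f0 g0 fin; rewrite /rev_ineqI.
have [f0' g0'] : (forall x, 0 <= f x) /\ (forall x, 0 <= g x).
  by split => x; exact: ltW.
have [M [X [M0 [X0 XM] SE XE ->]]] :=
  sum_rhsE _ _ _ (ltr0_neq0 p0) mf mg f0' g0' fin.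
have mX := measurable_fun_powR _ (p / 2) (measurable_funM mf mg).
have mS : measurable_fun setT (fun x => f x `^ p + g x `^ p).
  by apply: measurable_funD; exact: measurable_fun_powR.
have mF : measurable_fun setT (fun x => (f x + g x) `^ p).
  by apply: measurable_fun_powR; exact: measurable_funD.
have S0 x : 0 <= f x `^ p + g x `^ p by rewrite addr_ge0 ?powR_ge0.
(* The integrand of [X] is positive everywhere, so [X = 0] would force every integral to vanish, in
   particular [M]. *)
have {}X0 : 0 < X.
  rewrite lt_neqAle X0 andbT; apply/eqP => X0'.
  suff : M%:E = 0%E by case=> M0'; rewrite M0' ltxx in M0.
  rewrite -SE -(integral0 mu setT).
  apply: (integral_eq0_eq_integral mu _ _ _ mX mS (measurable_cst _)).
  - by move=> x; exact: powR_ge0.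
  - by rewrite XE -X0'.
  - by move=> x /eqP; rewrite gt_eqF// powR_gt0// mulr_gt0.
set m := 2 * X / M.
have m0 : 0 < m by rewrite divr_gt0// mulr_gt0.
have m1 : m <= 1 by rewrite ler_pdivrMr// mul1r.
have l0 : 0 <= dsharp p m.
  rewrite mulr_ge0 ?powR_ge0// mulr_le0 ?invr_le0 ?ltW//.
  by rewrite pmulr_rlt0// subr_lt0; lra.
have s0 : 0 <= sharp p m by exact: powR_ge0.
have key x :=
  sharp_tangent_powR p m (f x) (g x) p0 m0 m1 (f0 x) (g0 x).
move: (dsharp p m) (sharp p m) l0 s0 key => l s l0 s0 key.
have mc (c : R) h : measurable_fun setT h ->
    measurable_fun setT (fun x : T => c * h x).
  by move=> mh; apply: measurable_funM => //; exact: measurable_cst.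
have sS0 x : 0 <= s * (f x `^ p + g x `^ p) by exact: mulr_ge0.
have [lm0 l20] : 0 <= l * m /\ 0 <= l * 2 by split; rewrite mulr_ge0// ltW.
have lS0 x : 0 <= l * m * (f x `^ p + g x `^ p) by exact: mulr_ge0.
have lX0 x : 0 <= l * 2 * (f x * g x) `^ (p / 2) by rewrite mulr_ge0// powR_ge0.
have F0 x : 0 <= (f x + g x) `^ p by exact: powR_ge0.
have XE0 x : 0 <= (f x * g x) `^ (p / 2) by exact: powR_ge0.
(* The negative part of the tangent inequality is moved to the right, so that only nonnegative
   functions are integrated. *)
have := ge0_EFin_le_integral mu
  (fun x => s * (f x `^ p + g x `^ p) + l * 2 * (f x * g x) `^ (p / 2))
  (fun x => (f x + g x) `^ p + l * m * (f x `^ p + g x `^ p)).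
rewrite (ge0_EFin_integralD _ _ _ (mc _ _ mS) (mc _ _ mX))//.
rewrite (ge0_EFin_integralD _ _ _ mF (mc _ _ mS))//.
rewrite !(ge0_EFin_integralZl _ _ _ mS)// (ge0_EFin_integralZl _ _ _ mX)//.
rewrite SE XE -!EFinM.
(* The choice [m = 2X/M] makes the first-order terms cancel after integration. *)
have -> : l * 2 * X = l * m * M.
  by rewrite -[LHS]mulrA -[RHS]mulrA /m divfK// gt_eqF.
rewrite leeD2rE// => h; apply: h.
- by apply: measurable_funD; exact: mc.
- by apply: measurable_funD => //; exact: mc.
- by move=> x; exact: addr_ge0.
- by move=> x; have := key x; lra.
Qed.

End sum_rhs.

(** * Doubling the exponent by convexity *)

(** Convexity of [t^p] at the points [u/l] and [v/(1-l)] with weights [l] and [1-l]. *)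
Lemma powRD_le (R : realType) (p l u v : R) : 1 <= p -> 0 < l -> l < 1 ->
  0 <= u -> 0 <= v ->
  (u + v) `^ p <= l `^ (1 - p) * u `^ p + (1 - l) `^ (1 - p) * v `^ p.
Proof.
move=> p1 l0 l1 u0 v0; have l'0 : 0 < 1 - l by rewrite subr_gt0.
have E t w : 0 < t -> 0 <= w -> t `^ (1 - p) * w `^ p = t * (w / t) `^ p.
  move=> t0 w0; rewrite powRM ?invr_ge0 ?(ltW t0)// -powR_inv1 ?(ltW t0)//.
  rewrite -powRrM mulN1r (@powRD _ t 1) ?(gt_eqF t0) ?implybT//.
  rewrite (powRr1 (ltW t0)).
  by rewrite -mulrA [X in _ * X = _]mulrC.
rewrite !E//.
have -> : u + v = l * (u / l) + (1 - l) * (v / (1 - l)).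
  by rewrite ![_ * (_ / _)]mulrC !divfK ?gt_eqF.
by apply: (convex_powR p1 (Itv01 (ltW l0) (ltW l1)));
  rewrite inE/= in_itv/= divr_ge0 ?(ltW l0) ?(ltW l'0).
Qed.

Section doubling.
Context {R : realType} {d : measure_display} {T : measurableType d}.
Variable mu : {measure set T -> \bar R}.

Lemma sqr_powR (x p : R) : 0 <= x -> (x ^+ 2) `^ p = x `^ (2 * p).
Proof. by move=> x0; rewrite -powR_mulrn// -powRrM. Qed.

Lemma ineqI_valid_double (p : R) : 1 <= p ->
  ineqI_valid mu p -> ineqI_valid mu (2 * p).
Proof.
move=> p1 Ip f g mf mg f0 g0 fin; rewrite /ineqI.
have p0 : 0 < p by lra.
have [mf2 mg2] := (measurable_funX 2 mf, measurable_funX 2 mg).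
have fin2 : finite_pos_mass mu p (fun x => f x ^+ 2) (fun x => g x ^+ 2).
  rewrite /finite_pos_mass.
  under eq_integral do rewrite sqr_powR//.
  by under [X in (_ + X)%E]eq_integral do rewrite sqr_powR//.
have := Ip _ _ mf2 mg2 (fun x => sqr_ge0 (f x)) (fun x => sqr_ge0 (g x)) fin2.
have [M [X [M0 [X0 XM] SE XE rhsE]]] := sum_rhsE mu _ _ _ (lt0r_neq0 p0) mf2 mg2
  (fun x => sqr_ge0 (f x)) (fun x => sqr_ge0 (g x)) fin2.
rewrite /ineqI rhsE {rhsE}.
have p20 : 2 * p != 0 by rewrite mulf_neq0// gt_eqF.
have [N [Y [N0 [Y0 YN] SE' XE' ->]]] := sum_rhsE mu _ _ _ p20 mf mg f0 g0 fin.
have pE : 2 * p / 2 = p by field.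
rewrite pE in XE'.
(* The inequality for [f^2, g^2] at [p] and the one for [f, g] at [2p] involve the same two
   integrals. *)
have NM : N = M.
  apply: EFin_inj; rewrite -SE -SE'.
  by apply: eq_integral => x _; rewrite !sqr_powR.
have YX : Y = X.
  apply: EFin_inj; rewrite -XE -XE'; apply: eq_integral => x _.
  by rewrite -exprMn sqr_powR ?mulr_ge0// [2 * _]mulrC divfK.
rewrite {}NM {}YX in SE' XE' *; move=> {N Y N0 Y0 YN fin fin2 Ip SE XE} Ip.
have mX : measurable_fun setT (fun x => (f x * g x) `^ p).
  by apply: measurable_fun_powR; exact: measurable_funM.
have mF : measurable_fun setT (fun x => (f x + g x) `^ (2 * p)).
  by apply: measurable_fun_powR; exact: measurable_funD.
have mG : measurable_fun setT (fun x => (f x ^+ 2 + g x ^+ 2) `^ p).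
  by apply: measurable_fun_powR; exact: measurable_funD.
(* If [X = 0], then [f g = 0] almost everywhere, so [(f+g)^(2p) = f^(2p) + g^(2p)] there, while
   [sharp] equals 1 at 0: equality holds. *)
have [X00|Xn0] := eqVneq X 0.
  rewrite X00 mulr0 mul0r /sharp powR0 ?mulf_neq0 ?invr_eq0// addr0 powR1 mul1r.
  rewrite -SE' /sum_lhs le_eqVlt; apply/orP; left; apply/eqP.
  apply: (integral_eq0_eq_integral mu _ _ _ mX) => //.
  - by apply: measurable_funD; exact: measurable_fun_powR.
  - by move=> x; exact: powR_ge0.
  - by rewrite XE' X00.
  move=> x /powR_eq0_eq0/eqP; rewrite mulf_eq0 => /orP[]/eqP ->.
    by rewrite powR0// !add0r.
  by rewrite powR0// !addr0.
have {}X0 : 0 < X by rewrite lt0r Xn0.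
have t0 : 0 < 2 * X / M by rewrite divr_gt0// mulr_gt0.
have [a [a0 aE shE ->]] : exists a, [/\ 0 < a, a `^ p = 2 * X / M,
    sharp p (2 * X / M) = (1 + a ^+ 2) `^ (p - 1) &
    sharp (2 * p) (2 * X / M) = (1 + a) `^ (2 * p - 1)].
  move: (2 * X / M) t0 => t t0; exists (t `^ p^-1); split.
  - exact: powR_gt0.
  - by rewrite -powRrM mulVf ?gt_eqF// (powRr1 (ltW t0)).
  - by rewrite /sharp -(powR_mulrn 2 (powR_ge0 _ _)) -powRrM [2 / p]mulrC.
  - by rewrite /sharp (_ : 2 / (2 * p) = p^-1)// invfM mulrA divff// mul1r.
rewrite {}shE in Ip.
(* With this choice [l^(1-p) (1+a^2)^(p-1)] and [(1-l)^(1-p) (2a)^(p-1)] both equal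
   [(1+a)^(2p-2)]. *)
pose l := (1 + a ^+ 2) / (1 + a) ^+ 2.
have q0 : 0 < (1 + a) ^+ 2 by rewrite exprn_gt0// addr_gt0.
have n0 : 0 < 1 + a ^+ 2 by rewrite addr_gt0// exprn_gt0.
have l0 : 0 < l by rewrite divr_gt0.
have lC : 1 - l = 2 * a / (1 + a) ^+ 2.
  by rewrite /l; field; rewrite gt_eqF ?addr_gt0.
have l1 : l < 1 by rewrite -subr_gt0 lC divr_gt0// mulr_gt0.
have mc (c : R) h : measurable_fun setT h ->
    measurable_fun setT (fun x : T => c * h x).
  by move=> mh; apply: measurable_funM => //; exact: measurable_cst.
pose A := l `^ (1 - p); pose B := (1 - l) `^ (1 - p) * 2 `^ p.
have A0 : 0 <= A by exact: powR_ge0.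
have B0 : 0 <= B by rewrite mulr_ge0 ?powR_ge0.
apply: (@le_trans _ _ (A%:E *
    sum_lhs mu p (fun x => f x ^+ 2)%R (fun x => g x ^+ 2)%R + B%:E * X%:E)%E).
  rewrite -XE' -!ge0_EFin_integralZl//; do ?by move=> x; exact: powR_ge0.
  rewrite -ge0_EFin_integralD;
    do ?[exact: mc|by move=> x; rewrite mulr_ge0 ?powR_ge0].
  apply: ge0_EFin_le_integral => //.
  - by apply: measurable_funD; exact: mc.
  - by move=> x; exact: powR_ge0.
  move=> x; have [fx gx] := (f0 x, g0 x).
  have -> : (f x + g x) `^ (2 * p) =
      (f x ^+ 2 + g x ^+ 2 + 2 * (f x * g x)) `^ p.
    by rewrite -sqr_powR ?addr_ge0//; congr (_ `^ _); ring.
  rewrite -[B * _]mulrA -powRM ?mulr_ge0//.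
  by apply: powRD_le => //; rewrite ?addr_ge0 ?sqr_ge0 ?mulr_ge0.
(* The assumed inequality at [p] for [f^2, g^2] bounds the first term. *)
apply: (@le_trans _ _ (A%:E * ((1 + a ^+ 2) `^ (p - 1) * M)%:E
    + B%:E * X%:E)%E).
  by rewrite leeD2r// lee_wpmul2l.
rewrite -!EFinM -EFinD lee_fin.
have -> : X = a `^ p / 2 * M by rewrite aE; field; rewrite gt_eqF.
have divE u : 0 < u -> (u / (1 + a) ^+ 2) `^ (1 - p) * u `^ (p - 1) =
    (1 + a) `^ (2 * p - 2).
  move=> u0; rewrite powRM ?invr_ge0 ?(ltW q0) ?(ltW u0)// mulrAC.
  rewrite -(@powRD _ u) ?(gt_eqF u0) ?implybT//.
  have -> : 1 - p + (p - 1) = 0 by ring.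
  rewrite powRr0 mul1r.
  rewrite -[_^-1]powR_inv1 ?(ltW q0)// -powRrM sqr_powR ?addr_ge0 ?(ltW a0)//.
  by congr (_ `^ _); ring.
have powRS u : 0 < u -> u `^ p = u * u `^ (p - 1).
  by move=> u0; rewrite mulr_powRB1// ltW.
have -> : A * ((1 + a ^+ 2) `^ (p - 1) * M) = (1 + a) `^ (2 * p - 2) * M.
  by rewrite mulrA /A /l divE.
have -> : B * (a `^ p / 2 * M) = a * (1 + a) `^ (2 * p - 2) * M.
  rewrite /B lC -(divE (2 * a)) ?mulr_gt0//.
  rewrite [(2 * a) `^ (p - 1)]powRM ?(ltW a0)//.
  by rewrite (powRS a)// (powRS 2)//; move: (_ `^ (1 - p)) => Z; field.
(* The two terms add up to [(1 + a) (1+a)^(2p-2) M]. *)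
rewrite -mulrDl -[X in X + _]mul1r -mulrDl.
rewrite -[X in X * _ `^ _]powRr1 ?addr_ge0 ?(ltW a0)//.
rewrite -(@powRD _ (1 + a)) ?(gt_eqF (addr_gt0 _ a0)) ?implybT//.
by have -> : 1 + (2 * p - 2) = 2 * p - 1 by ring.
Qed.

End doubling.

Theorem proposition5p1 (R : realType) (d : measure_display)
    (T : measurableType d) (mu : {measure set T -> \bar R}) :
  (forall p : R, 2 <= p -> ineqI_valid mu p -> ineqI_valid mu (2 * p)) /\
  (forall p : R, p < 0 -> rev_ineqI_valid mu p -> rev_ineqI_valid mu (2 * p)).
Proof.
split=> p hp; first by apply: ineqI_valid_double; lra.
by move=> _; apply: rev_ineqI_valid_lt0; lra.
Qed.
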